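(* Let $(\mathscr{X},\varphi,\odot)$ be a probabilistic normed space, and let $\alpha(n)$ and $\vartheta(n)$ be sequences of non-negative integers with $\alpha(n)<\vartheta(n)$ for all $n$ and $\lim_{n\to\infty}\vartheta(n)=\infty$. Let $\{w_k\}_{k\in\mathbb{N}}$ be a sequence in $\mathscr{X}$. If $\{w_k\}$ is $\mathscr{D}_\alpha^\vartheta(\mathcal{S}^\varphi)$-convergent (that is, deferred statistically convergent with respect to $\varphi$ to some $\xi\in\mathscr{X}$), then $\{w_k\}$ is a deferred statistically Cauchy sequence with respect to $\varphi$.
   Context: Here $\mathbb{N}=\{1,2,\dots\}$ and $\mathbb{R}_0^+=[0,\infty)$. A continuous $t$-norm is a binary operation $\odot:[0,1]\times[0,1]\to[0,1]$ that is associative, commutative, continuous, satisfies $a\odot 1=a$ for all $a\in[0,1]$, and satisfies $a\odot b\le c\odot d$ whenever $a\le c$ and $b\le d$. A distribution function is a non-decreasing, left-continuous function $\mathscr{G}:\mathbb{R}\to\mathbb{R}_0^+$ with $\inf_{t}\mathscr{G}(t)=0$ and $\sup_t\mathscr{G}(t)=1$; $\Delta$ is the set of all distribution functions. A probabilistic normed space (PNS) is a triple $(\mathscr{X},\varphi,\odot)$ where $\mathscr{X}$ is a real vector space, $\odot$ is a continuous $t$-norm, and $\varphi:\mathscr{X}\to\Delta$ (writing $\varphi(\tau;\varepsilon)$ for the value of $\varphi(\tau)$ at $\varepsilon\in\mathbb{R}$) satisfies: (1) $\varphi(\tau;0)=0$ for all $\tau$; (2) $\varphi(\tau;\varepsilon)=1$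 for all $\varepsilon>0$ if and only if $\tau$ is the zero vector; (3) $\varphi(\kappa\tau;\varepsilon)=\varphi(\tau;\varepsilon/|\kappa|)$ for all $\kappa\in\mathbb{R}\setminus\{0\}$, $\varepsilon>0$; (4) $\varphi(\tau+\zeta;\varepsilon+\lambda)\ge\varphi(\tau;\varepsilon)\odot\varphi(\zeta;\lambda)$ for all $\tau,\zeta\in\mathscr{X}$ and $\varepsilon,\lambda\in\mathbb{R}_0^+$. Deferred statistical convergence of $\{w_k\}$ to $\xi$ with respect to $\varphi$ means that for every $\varepsilon>0$ and $\sigma\in(0,1)$, $$\lim_{n\to\infty}\frac{1}{\vartheta(n)-\alpha(n)}\left|\{k\in\mathbb{N}:\alpha(n)+1\le k\le\vartheta(n),\ \varphi(w_k-\xi;\varepsilon)\le 1-\sigma\}\right|=0.$$ Deferred statistically Cauchy: for every $\varepsilon>0$ and $\sigma\in(0,1)$ there is $n_0\in\mathbb{N}$ (allowed to depend on $\varepsilon$ and $\sigma$) such that $$\lim_{n\to\infty}\frac{1}{\vartheta(n)-\alpha(n)}\left|\{k\in\mathbb{N}:\alpha(n)+1\le k\le\vartheta(n),\ \varphi(w_k-w_{n_0};\varepsilon)\le 1-\sigma\}\right|=0.$$ *)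

(* Defs.v *)
From HB Require Import structures.
From mathcomp Require Import all_boot all_order all_algebra.
From mathcomp Require Import finmap.
From mathcomp Require Import all_classical all_reals all_analysis.
Set Implicit Arguments.
Unset Strict Implicit.
Unset Printing Implicit Defensive.
Import Order.TTheory GRing.Theory Num.Theory.
Import numFieldNormedType.Exports.
Local Open Scope classical_set_scope.
Local Open Scope ring_scope.

Definition in_unit {R : realType} (a : R) : Prop := 0 <= a <= 1.

(* The operation is a total function on R; only its values on [0,1] x [0,1]
   are constrained. *)
Record continuous_tnorm {R : realType} (op : R -> R -> R) : Prop := {
  tnorm_unit : forall a b, in_unit a -> in_unit b -> in_unit (op a b);
  tnormA : forall a b c, in_unit a -> in_unit b -> in_unit c ->
    op a (op b c) = op (op a b) c;
  tnormC : forall a b, in_unit a -> in_unit b -> op a b = op b a;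
  tnorm_continuous :
    {within `[0, 1] `*` `[0, 1], continuous (fun p : R * R => op p.1 p.2)};
  tnorm1 : forall a, in_unit a -> op a 1 = a;
  tnorm_mono : forall a b c d,
    in_unit a -> in_unit b -> in_unit c -> in_unit d ->
    a <= c -> b <= d -> op a b <= op c d }.

(* [inf] and [sup] are 0 by convention when the set is not bounded on the
   relevant side; [dist_ge0] and the value 1 of the sup rule this out. *)
Record distribution_function (R : realType) := DistributionFunction {
  dist_fun :> R -> R;
  dist_ge0 : forall t, 0 <= dist_fun t;
  dist_nondecreasing : {homo dist_fun : s t / s <= t};
  dist_left_continuous : forall t, dist_fun s @[s --> t^'-] --> dist_fun t;
  dist_inf : inf (range dist_fun) = 0;
  dist_sup : sup (range dist_fun) = 1 }.

Record probabilistic_normed_space {R : realType} (X : lmodType R)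
    (phi : X -> distribution_function R) (op : R -> R -> R) : Prop := {
  pns_tnorm : continuous_tnorm op;
  pns_at0 : forall x, phi x 0 = 0;
  pns_eq0 : forall x, (forall e, 0 < e -> phi x e = 1) <-> x = 0;
  pns_scale : forall x (k e : R), k != 0 -> 0 < e ->
    phi (k *: x) e = phi x (e / `|k|);
  pns_triangle : forall x y (e l : R), 0 <= e -> 0 <= l ->
    op (phi x e) (phi y l) <= phi (x + y) (e + l) }.

Definition deferred_bad_set {R : realType} {X : lmodType R}
    (phi : X -> distribution_function R) (alpha theta : nat -> nat)
    (w : nat -> X) (x : X) (e s : R) (n : nat) : set nat :=
  [set k : nat | (alpha n + 1 <= k <= theta n)%N /\ phi (w k - x) e <= 1 - s].

(* [fset_set] turns a finite set into an {fset _}; the bad set is finite since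
   it is bounded by [theta n]. *)
Definition deferred_density_zero {R : realType} {X : lmodType R}
    (phi : X -> distribution_function R) (alpha theta : nat -> nat)
    (w : nat -> X) (x : X) (e s : R) : Prop :=
  #|` fset_set (deferred_bad_set phi alpha theta w x e s n)|%:R
    / ((theta n)%:R - (alpha n)%:R) @[n --> \oo] --> (0 : R).

Definition deferred_stat_cvg_to {R : realType} {X : lmodType R}
    (phi : X -> distribution_function R) (alpha theta : nat -> nat)
    (w : nat -> X) (xi : X) : Prop :=
  forall e s : R, 0 < e -> 0 < s < 1 ->
    deferred_density_zero phi alpha theta w xi e s.

Definition deferred_stat_convergent {R : realType} {X : lmodType R}
    (phi : X -> distribution_function R) (alpha theta : nat -> nat)
    (w : nat -> X) : Prop :=
  exists xi : X, deferred_stat_cvg_to phi alpha theta w xi.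

(* Sequences are indexed by the positive integers: the term of index 0 is never
   used, hence the condition on [n0]. *)
Definition deferred_stat_cauchy {R : realType} {X : lmodType R}
    (phi : X -> distribution_function R) (alpha theta : nat -> nat)
    (w : nat -> X) : Prop :=
  forall e s : R, 0 < e -> 0 < s < 1 ->
    exists n0 : nat, (1 <= n0)%N /\
      deferred_density_zero phi alpha theta w (w n0) e s.

(* Main.v *)
(* Pick r with (1-r) op (1-r) > 1-s, by continuity of the t-norm at (1, 1). The
   indices k with phi (w k - xi) (e/2) <= 1 - r have deferred density 0, so some
   index n0 is outside; by the triangle inequality through xi, every index that
   is bad for (w n0, e, s) is bad for (xi, e/2, r). *)
Require Import Defs.
From HB Require Import structures.
From mathcomp Require Import all_boot all_order all_algebra.
From mathcomp Require Import finmap.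
From mathcomp Require Import all_classical all_reals all_analysis.
From mathcomp Require Import lra.
Set Implicit Arguments.
Unset Strict Implicit.
Unset Printing Implicit Defensive.
Import Order.TTheory GRing.Theory Num.Theory.
Import numFieldNormedType.Exports.
Local Open Scope classical_set_scope.
Local Open Scope ring_scope.

Lemma dist_le1 (R : realType) (F : distribution_function R) (t : R) : F t <= 1.
Proof.
have [hs|hs] := pselect (has_sup (range F)).
  by rewrite -(dist_sup F); apply: ub_le_sup; [case: hs | exists t].
(* Without a supremum, [sup] takes its default value 0, against [dist_sup]. *)
by have := dist_sup F; rewrite sup_out // => /esym/eqP; rewrite oner_eq0.
Qed.

Lemma dist_in_unit (R : realType) (F : distribution_function R) (t : R) :
  in_unit (F t).
Proof. by rewrite /in_unit dist_ge0 dist_le1. Qed.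

Lemma tnorm_near1 (R : realType) (op : R -> R -> R) (s : R) :
  continuous_tnorm op -> 0 < s ->
  exists r : R, 0 < r < 1 /\ 1 - s < op (1 - r) (1 - r).
Proof.
move=> T s0.
have I1 : in_unit (1 : R) by rewrite /in_unit ler01 lexx.
have A11 : (`[0, 1] `*` `[0, 1]) ((1, 1) : R * R).
  by split => /=; rewrite in_itv /= ler01 lexx.
have /subspace_continuousP/(_ _ A11) := tnorm_continuous T.
move=> /cvgrPdist_lt /(_ s s0).
rewrite near_withinE => /nbhs_ballP[d /= d0 dP].
(* The bound [d / 2] puts [1 - r] in the ball of radius [d] around 1; the bound [1 / 2] keeps
   [1 - r] inside the unit interval, as continuity is only known within the square. *)
pose r := Num.min (d / 2) (1 / 2).
have r0 : 0 < r by rewrite lt_min !divr_gt0.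
have rd : r <= d / 2 by rewrite ge_min lexx.
have r1 : r <= 1 / 2 by rewrite ge_min lexx orbT.
exists r; split; first by lra.
have Bd : ball (1 : R) d (1 - r).
  by rewrite /ball /= opprB addrC subrK gtr0_norm //; lra.
have Ir : [set` `[0, 1]] (1 - r) by rewrite /= in_itv /=; lra.
have /= := dP (1 - r, 1 - r) (conj Bd Bd) (conj Ir Ir).
by rewrite /from_subspace /= (tnorm1 T I1) => /ltr_normlW; lra.
Qed.

Section ProbabilisticNorm.
Context {R : realType} {X : lmodType R} {phi : X -> distribution_function R}
  {op : R -> R -> R} (pns : probabilistic_normed_space phi op).

Lemma pnsN (x : X) (e : R) : 0 < e -> phi (- x) e = phi x e.
Proof.
move=> e0; rewrite -scaleN1r (pns_scale pns) ?oppr_eq0 ?oner_eq0 //.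
by rewrite normrN1 divr1.
Qed.

(** Triangle inequality for [x - y = (x - z) + - (y - z)] with [e] split into halves; [pnsN] removes
    the sign, and monotonicity of the t-norm brings in the two lower bounds. *)
Lemma pns_dist_half (x y z : X) (e r : R) : 0 < e -> 0 < r < 1 ->
  1 - r < phi (x - z) (e / 2) -> 1 - r < phi (y - z) (e / 2) ->
  op (1 - r) (1 - r) <= phi (x - y) e.
Proof.
move=> e0 r01 hx hy; have e20 : 0 < e / 2 by rewrite divr_gt0.
have Ir : in_unit (1 - r) by rewrite /in_unit; lra.
have := pns_triangle pns (x - z) (- (y - z)) (ltW e20) (ltW e20).
rewrite -splitr opprB addrA subrK -(opprB y z) pnsN //; apply: le_trans.
by apply: (tnorm_mono (pns_tnorm pns)) => //;
  [exact: dist_in_unit | exact: dist_in_unit | exact: ltW | exact: ltW].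
Qed.

End ProbabilisticNorm.

Section DeferredDensity.
Context {R : realType} {X : lmodType R} (phi : X -> distribution_function R)
  (alpha theta : nat -> nat)
  (alpha_lt_theta : forall n : nat, (1 <= n)%N -> (alpha n < theta n)%N)
  (w : nat -> X).

Lemma deferred_bad_set_finite (x : X) (e s : R) (n : nat) :
  finite_set (deferred_bad_set phi alpha theta w x e s n).
Proof.
apply: (sub_finite_set _ (finite_II (theta n).+1)) => k /= [/andP[_ kt] _].
by rewrite ltnS.
Qed.

Lemma deferred_density_zero_sub (x y : X) (e s e' s' : R) :
  (forall n, deferred_bad_set phi alpha theta w y e' s' n `<=`
             deferred_bad_set phi alpha theta w x e s n) ->
  deferred_density_zero phi alpha theta w x e s ->
  deferred_density_zero phi alpha theta w y e' s'.
Proof.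
move=> sub; apply: squeeze_cvgr; [|exact: cvg_cst].
near=> n.
(* The denominator is known to be positive only from index 1 on, which is enough for a limit. *)
have n1 : (1 <= n)%N by near: n; exists 1%N.
have gap : 0 < (theta n)%:R - (alpha n)%:R :> R.
  by rewrite subr_gt0 ltr_nat alpha_lt_theta.
rewrite divr_ge0 ?ler0n ?(ltW gap) //= ler_pM2r ?invr_gt0 // ler_nat.
apply: fsubset_leq_card.
by rewrite -fset_set_sub //; exact: deferred_bad_set_finite.
Unshelve. all: by end_near. Qed.

(** If every positive index were bad, each bad set would fill its whole window and the quotient
    would be constantly 1, so it could not tend to 0. *)
Lemma deferred_density_zero_good (x : X) (e s : R) :
  deferred_density_zero phi alpha theta w x e s ->
  exists k : nat, (1 <= k)%N /\ 1 - s < phi (w k - x) e.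
Proof.
(* A single index suffices: one past the threshold [N] for tolerance 1, and positive so that its
   window is nonempty. *)
move=> /cvgrPdist_lt /(_ 1 ltr01) [N _ /(_ (maxn N 1) (leq_maxl _ _)) /=].
set n := maxn N 1 => dens; apply: contrapT => nogood.
have n1 : (1 <= n)%N by exact: leq_maxr.
have lt_n := alpha_lt_theta n1.
suff cardE : #|` fset_set (deferred_bad_set phi alpha theta w x e s n)| =
    (theta n - alpha n)%N.
  move: dens; rewrite cardE natrB ?(ltnW lt_n) // divff ?sub0r ?normrN1 ?ltxx //.
  by rewrite subr_eq0 eqr_nat gtn_eqF.
(* Writing the window as a duplicate-free [iota] lets its cardinal be read off as a length. *)
have -> : deferred_bad_set phi alpha theta w x e s n =
    [set` [fset k in iota (alpha n).+1 (theta n - alpha n)]%fset].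
  apply/seteqP; split => k /=;
    rewrite in_fset /= mem_iota addSn subnKC ?(ltnW lt_n) // ltnS -(addn1 (alpha n)).
    by case.
  (* A good index in the window is at least [alpha n + 1], hence positive, and contradicts
     [nogood]. *)
  move=> kn; split => //; rewrite leNgt; apply/negP => good.
  by apply: nogood; exists k; split => //; case/andP: kn => + _; rewrite addn1; apply: leq_trans.
by rewrite set_fsetK card_fseq undup_id ?iota_uniq // size_iota.
Qed.

End DeferredDensity.

Theorem theorem3p8 (R : realType) (X : lmodType R)
    (phi : X -> distribution_function R) (op : R -> R -> R)
    (pns : probabilistic_normed_space phi op)
    (alpha theta : nat -> nat)
    (alpha_lt_theta : forall n : nat, (1 <= n)%N -> (alpha n < theta n)%N)
    (theta_oo : theta n @[n --> \oo] --> \oo)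
    (w : nat -> X)
    (w_cvg : deferred_stat_convergent phi alpha theta w) :
  deferred_stat_cauchy phi alpha theta w.
Proof.
case: w_cvg => xi w_xi e s e0 s01; have /andP[s0 _] := s01.
have [r [r01 opr]] := tnorm_near1 (pns_tnorm pns) s0.
have dens : deferred_density_zero phi alpha theta w xi (e / 2) r.
  by apply: w_xi => //; rewrite divr_gt0.
have [n0 [n0_ge1 good0]] := deferred_density_zero_good alpha_lt_theta dens.
exists n0; split => //.
(* The inclusion of bad sets is shown by contraposition: if [k] is good for [xi], then [w k] and
   [w n0] are both close to [xi], hence to each other. *)
apply: (deferred_density_zero_sub alpha_lt_theta _ dens) => n k [kn bad].
split => //; rewrite leNgt; apply/negP => good.
have := pns_dist_half pns e0 r01 good good0.
by move=> /(lt_le_trans opr); rewrite ltNge bad.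
Qed.
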